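(* Let $X$ be a Hausdorff topological space with no isolated points, and let $G$ be a group acting faithfully and highly transitively on $X$ by homeomorphisms (that is, $G$ is a highly transitive group of permutations of $X$ all of whose elements are homeomorphisms of $X$). Then the group Zariski topology on $G$ is irreducible.
   Context: The group Zariski topology $\mathfrak{Z}_G$ on a group $G$ with identity $1_G$ is the topology on $G$ with subbasis consisting of the sets $\{x\in G \mid 1_G\neq g_0x^{k_0}g_1\cdots g_{l-1}x^{k_{l-1}}g_l\}$, where $l\in\mathbb{N}=\{0,1,2,\ldots\}$, $g_0,\ldots,g_l\in G$ and $k_0,\ldots,k_{l-1}\in\mathbb{Z}$. A topological space $Y$ is irreducible if $K_1\cup K_2\neq Y$ whenever $K_1,K_2\subsetneq Y$ are closed; equivalently, every non-empty open subset of $Y$ is dense. A group $G$ of permutations of a set $X$ is highly transitive if for every bijection $\sigma$ between finite subsets of $X$ there is $g\in G$ extending $\sigma$. *)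

(* Defs.v *)
From HB Require Import structures.
From mathcomp Require Import all_boot all_order all_algebra.
From mathcomp Require Import all_classical.
From mathcomp Require Import topology.

Set Implicit Arguments.
Unset Strict Implicit.
Unset Printing Implicit Defensive.

Local Open Scope classical_set_scope.
Local Open Scope group_scope.

(* Integer powers in a group: [x ^+ n] and [x ^- n] take [n : nat]. *)
Definition expgz (G : groupType) (x : G) (k : int) : G :=
  match k with
  | Posz n => x ^+ n
  | Negz n => x ^- n.+1
  end.

(* g_0 x^{k_0} g_1 ... g_{l-1} x^{k_{l-1}} g_l; only the values g_0, ..., g_l
   and k_0, ..., k_{l-1} of the sequences g and k are used. *)
Definition zariski_word (G : groupType) (l : nat) (g : nat -> G)
    (k : nat -> int) (x : G) : G :=
  g 0 * \prod_(i < l) (expgz x (k i) * g i.+1).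

Definition zariski_subbase (G : groupType) : set (set G) :=
  [set U | exists (l : nat) (g : nat -> G) (k : nat -> int),
     U = [set x | 1 <> zariski_word l g k x]].

(* A copy of G carrying the group Zariski topology. *)
Definition group_zariski (G : groupType) : Type := G.

HB.instance Definition _ (G : groupType) := Group.on (group_zariski G).

HB.instance Definition _ (G : groupType) :=
  @isSubBaseTopological.Build (group_zariski G)
    (set (group_zariski G)) (@zariski_subbase G) id.

Definition irreducible_space (Y : topologicalType) : Prop :=
  forall K1 K2 : set Y, closed K1 -> closed K2 ->
    K1 `<` [set: Y] -> K2 `<` [set: Y] -> K1 `|` K2 <> [set: Y].

Definition homeomorphism (X Y : topologicalType) (f : X -> Y) : Prop :=
  continuous f /\
  exists f' : Y -> X, [/\ cancel f f', cancel f' f & continuous f'].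

Definition is_group_action (G : groupType) (X : Type) (act : G -> X -> X) :
    Prop :=
  (forall x, act 1 x = x) /\ (forall g h x, act (g * h) x = act g (act h x)).

Definition faithful_action (G : groupType) (X : Type) (act : G -> X -> X) :
    Prop :=
  forall g, (forall x, act g x = x) -> g = 1.

(* A bijection between subsets A and B of X is given by a map s : X -> X whose
   values outside A are irrelevant. *)
Definition highly_transitive (G : groupType) (X : Type) (act : G -> X -> X) :
    Prop :=
  forall (A B : set X) (s : X -> X), finite_set A -> finite_set B ->
    set_bij A B s -> exists g, forall x, A x -> act g x = s x.

(* Main.v *)
Require Import Defs.
From mathcomp Require Import all_boot all_order all_algebra.
From mathcomp Require Import finmap.
From mathcomp Require Import all_classical.
From mathcomp Require Import topology.

Local Open Scope classical_set_scope.

(** A group element is controlled here through finitely many of its values on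
    [X].  Suppose that a word takes a value [w(g) <> 1].  By faithfulness [w(g)]
    moves a point.  The points moved by a continuous map of a Hausdorff space form
    an open set, which is then infinite because [X] is Hausdorff without isolated points.  Whether [w(g)]
    moves [p] depends only on the values of [g] at the finitely many points that
    the letters of [w] meet while [p] travels along the word, and each of these
    points, as well as its image under [g], is a bijective function of [p].  So
    [p] can be chosen to keep them all away from any given finite subset of [X].

    A finite partial injection of [X], avoiding any finite set chosen in
    advance, therefore forces [w(x) <> 1] for all [x] extending it
    ([prescribable_moving]).  Partial injections that avoid each other glue to a
    partial injection, so this property passes to finite intersections
    ([prescribableI]), and it holds for every non-empty open set of the group
    Zariski topology.  High transitivity extends the glued injection to an
    element of [G] ([prescribable_nonempty]): two non-empty open sets always
    meet. *)

(** * Open sets of a Hausdorff space without isolated points *)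

Lemma open_moved_points (X : topologicalType) (f : X -> X) :
  hausdorff_space X -> continuous f -> open [set x | f x <> x].
Proof.
move=> hX cf; rewrite openE => p /= /eqP fpp.
have := hX; rewrite open_hausdorff => /(_ _ _ fpp) [[U V]] /= [Ufp Vp] [oU oV UV0].
have Wp : nbhs p (f @^-1` U `&` V).
  apply: filterI; last by apply: open_nbhs_nbhs; split=> //; exact: set_mem.
  by apply: cf; apply: open_nbhs_nbhs; split=> //; exact: set_mem.
apply: filterS Wp => x [Ufx Vx] fxx.
have : (U `&` V) x by split=> //; move: Ufx; rewrite /= fxx.
by rewrite (eqP UV0).
Qed.

(** A finite set is closed, so in a finite open set one may remove all points
    but one and keep an open set: the remaining point is isolated. *)
Lemma open_infinite (X : topologicalType) (O : set X) :
  hausdorff_space X -> isolated [set: X] = set0 ->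
  open O -> O !=set0 -> infinite_set O.
Proof.
move=> hX iX oO [p Op] finO.
have oOp : open (O `&` ~` (O `\ p)).
  apply: openI => //; rewrite openC.
  apply: (accessible_finite_set_closed.1 (hausdorff_accessible hX)).
  exact: finite_setD.
suff : isolated [set: X] p by rewrite iX.
split; first by rewrite inE.
exists (O `&` ~` (O `\ p)).
  by apply: open_nbhs_nbhs; split=> //; split=> // -[_ /(_ erefl)].
rewrite setIT; apply/seteqP; split=> x /=; last by move=> ->; split=> // -[_ /(_ erefl)].
by move=> [Ox nx]; apply: contrapT => xp; apply: nx.
Qed.

(** * Neighbourhoods in the group Zariski topology *)

Lemma group_zariski_open_base (G : groupType) (U : set (group_zariski G)) x :
  open U -> U x -> exists E : set (set G),
    [/\ finite_set E, forall V, E V -> zariski_subbase V /\ V x &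
        \bigcap_(V in E) V `<=` U].
Proof.
move=> [D fromD <-] [V DV Vx]; have [E /= sE VE] := fromD _ DV; subst V.
exists [set` E]; split; first exact: finite_fset.
  by move=> W EW; split; [have := sE _ EW; rewrite inE | exact: Vx].
by move=> y Ey; exists (\bigcap_(W in [set` E]) W).
Qed.

Section FiniteData.

Local Open Scope group_scope.

Context {X : Type} {G : groupType} {act : G -> X -> X}
  (action : is_group_action act).

Let act1 x : act 1 x = x. Proof. exact: action.1. Qed.
Let actM g h x : act (g * h) x = act g (act h x). Proof. exact: action.2. Qed.

Lemma actK (g : G) : cancel (act g) (act g^-1).
Proof. by move=> x; rewrite -actM mulVg act1. Qed.

Lemma actVK (g : G) : cancel (act g^-1) (act g).
Proof. by move=> x; rewrite -actM mulgV act1. Qed.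

(** * Words depend on finitely many values of their argument *)

(** The elements of [S] send [p] to the points at which the trajectory of [p]
    along [w(g)] consults [g].  It matters that [S] is the same for all [p] and
    consists of bijections of [X]: only finitely many [p] then have a trajectory
    meeting a given finite set. *)
Definition finitely_tracked (w : G -> G) :=
  forall g, exists2 S : set G, finite_set S & forall g' p,
    (forall h, S h -> act g' (act h p) = act g (act h p)) ->
    act (w g') p = act (w g) p.

Lemma finitely_tracked_cst a : finitely_tracked (fun=> a).
Proof. by move=> g; exists set0. Qed.

Lemma finitely_tracked_id : finitely_tracked id.
Proof.
move=> g; exists [set 1]; first exact: finite_set1.
by move=> g' p /(_ 1 erefl); rewrite act1.
Qed.

(** A point is first moved by [v g], then by [u g]; hence the shift by [v g] of
    the elements that track [u]. *)
Lemma finitely_tracked_mul u v : finitely_tracked u -> finitely_tracked v ->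
  finitely_tracked (fun x => u x * v x).
Proof.
move=> tu tv g; have [S finS uS] := tu g; have [T finT vT] := tv g.
exists (T `|` [set h * v g | h in S]).
  by rewrite finite_setU; split=> //; exact: finite_image.
move=> g' p agree; rewrite !actM vT; last by move=> h Th; apply: agree; left.
by apply: uS => h Sh; rewrite -(actM h); apply: agree; right; exists h.
Qed.

(** Inverting [u g] at [p] amounts to following the trajectory that starts at
    the preimage of [p] under [u g]. *)
Lemma finitely_tracked_inv u :
  finitely_tracked u -> finitely_tracked (fun x => (u x)^-1).
Proof.
move=> tu g; have [S finS uS] := tu g.
exists [set h * (u g)^-1 | h in S]; first exact: finite_image.
move=> g' p agree; apply: (can_inj (actK (u g'))); rewrite actVK.
rewrite uS ?actVK// => h Sh; rewrite -(actM h); apply: agree; by exists h.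
Qed.

Lemma finitely_tracked_expg u n :
  finitely_tracked u -> finitely_tracked (fun x => u x ^+ n).
Proof.
move=> tu; elim: n => [|n IHn]; first exact: finitely_tracked_cst.
by under eq_fun do rewrite expgS; exact: finitely_tracked_mul.
Qed.

Lemma finitely_tracked_zariski_word l g k :
  finitely_tracked (zariski_word l g k).
Proof.
apply: finitely_tracked_mul; first exact: finitely_tracked_cst.
elim: l => [|l IHl].
  by under eq_fun do rewrite big_ord0; exact: finitely_tracked_cst.
under eq_fun do rewrite big_ord_recr.
apply: finitely_tracked_mul => //.
apply: finitely_tracked_mul; last exact: finitely_tracked_cst.
case: (k l) => n /=; first exact/finitely_tracked_expg/finitely_tracked_id.
exact/finitely_tracked_inv/finitely_tracked_expg/finitely_tracked_id.
Qed.

(** * Sets forced by finite partial injections *)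

(** Avoiding [F] both with the domain [A] and with the image is what makes it
    possible to glue the partial injections of several sets [U]. *)
Definition prescribable (U : set G) :=
  forall F : set X, finite_set F -> exists A : set X, exists s : X -> X,
    [/\ finite_set A, set_inj A s, A `&` F = set0, s @` A `&` F = set0 &
        forall g, {in A, act g =1 s} -> U g].

Lemma prescribableS (U V : set G) : U `<=` V -> prescribable U -> prescribable V.
Proof.
move=> UV pU F /pU[A [s [finA injs AF sAF AU]]].
by exists A, s; split=> // g /AU/UV.
Qed.

Lemma prescribableT : prescribable setT.
Proof.
by move=> F finF; exists set0, id; split=> //;
  rewrite ?image_set0 ?set0I// => x y; rewrite inE.
Qed.

(** The partial injection for [V] is chosen to avoid the domain and the image
    of the one for [U], so that their union is again injective. *)
Lemma prescribableI (U V : set G) :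
  prescribable U -> prescribable V -> prescribable (U `&` V).
Proof.
move=> pU pV F finF.
have [A [s [finA injs AF sAF AU]]] := pU F finF.
have finF' : finite_set (F `|` (A `|` s @` A)).
  by rewrite !finite_setU; split=> //; split=> //; exact: finite_image.
have [B [t [finB injt BF tBF BV]]] := pV _ finF'.
pose r x := if x \in A then s x else t x.
have rA x : A x -> r x = s x by move=> Ax; rewrite /r mem_set.
have BNA x : B x -> ~ A x.
  move=> Bx Ax; have : (B `&` (F `|` (A `|` s @` A))) x.
    by split=> //; right; left.
  by rewrite BF.
have rB x : B x -> r x = t x by move=> Bx; rewrite /r memNset//; exact: BNA.
have stN x y : A x -> B y -> s x <> t y.
  move=> Ax By sxty; have : (t @` B `&` (F `|` (A `|` s @` A))) (t y).
    by split; [exists y | right; right; exists x].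
  by rewrite tBF.
exists (A `|` B), r; split.
- by rewrite finite_setU.
- move=> x y; rewrite !inE => -[Ax|Bx] [Ay|By].
  + by rewrite !rA//; apply: injs; rewrite inE.
  + by rewrite (rA x)// (rB y)// => /stN; case.
  + by rewrite (rB x)// (rA y)// => /esym/stN; case.
  + by rewrite !rB//; apply: injt; rewrite inE.
- rewrite setIUl AF set0U -subset0 => x [Bx Fx].
  by rewrite -BF; split=> //; left.
- rewrite -subset0 => _ [[x [Ax|Bx] <-] Fr].
    by rewrite -sAF; split; [exists x => //; rewrite rA|].
  by rewrite -tBF; split; [exists x => //; rewrite rB|left].
- move=> g gr; split.
    by apply: AU => x; rewrite inE => Ax; rewrite -rA//; apply: gr; rewrite inE; left.
  by apply: BV => x; rewrite inE => Bx; rewrite -rB//; apply: gr; rewrite inE; right.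
Qed.

Lemma prescribable_bigcap (I : choiceType) (D : set I) (f : I -> set G) :
  finite_set D -> (forall i, D i -> prescribable (f i)) ->
  prescribable (\bigcap_(i in D) f i).
Proof.
move=> finD pf; rewrite -bigsetI_fset_set// big_seq.
elim/big_ind: _ => [||i]; [exact: prescribableT | exact: prescribableI |].
by rewrite in_fset_set// inE; exact: pf.
Qed.

Lemma prescribable_nonempty (U : set G) :
  highly_transitive act -> prescribable U -> U !=set0.
Proof.
move=> ht /(_ set0 (finite_set0 _)) [A [s [finA injs _ _ AU]]].
have [|g gA] := ht A (s @` A) s finA (finite_image s finA).
  by split=> // x Ax; exists x.
by exists g; apply: AU => x; rewrite inE; exact: gA.
Qed.

(** The partial injection is the restriction of [g] to the trajectory of a
    moved point; only the finitely many points of [bad] have a trajectory that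
    meets [F]. *)
Lemma prescribable_moving (w : G -> G) (g : G) :
  finitely_tracked w -> infinite_set [set p | act (w g) p <> p] ->
  prescribable [set x | w x <> 1].
Proof.
move=> /(_ g)[S finS wS] infM F finF.
pose bad := \bigcup_(h in S)
  ([set act h^-1 x | x in F] `|` [set act (g * h)^-1 x | x in F]).
have fin_bad : finite_set bad.
  by apply: bigcup_finite => // h _; rewrite finite_setU; split; exact: finite_image.
have [p [pM pbad]] := infinite_setN0 (infinite_setD infM fin_bad).
exists [set act h p | h in S], (act g); split.
- exact: finite_image.
- by move=> x y _ _; exact: (can_inj (actK g)).
- rewrite -subset0 => _ [[h Sh <-] Fhp]; apply: pbad.
  by exists h => //; left; exists (act h p) => //; rewrite actK.
- rewrite -subset0 => _ [[_ [h Sh <-] <-] Fghp]; apply: pbad.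
  by exists h => //; right; exists (act (g * h) p); rewrite ?actK // actM.
- move=> g' agree wg'1; apply: pM.
  rewrite -(wS g' p) ?wg'1 ?act1// => h Sh.
  by apply: agree; rewrite inE; exists h.
Qed.

End FiniteData.

(** * Irreducibility *)

Theorem theorem2p4 (X : topologicalType) (G : groupType) (act : G -> X -> X)
    (X_hausdorff : hausdorff_space X)
    (X_no_isolated : isolated [set: X] = set0)
    (act_action : is_group_action act)
    (act_faithful : faithful_action act)
    (act_highly_transitive : highly_transitive act)
    (act_homeo : forall g : G, homeomorphism (act g)) :
  irreducible_space (group_zariski G).
Proof.
have subbase_prescribable (U : set G) :
    zariski_subbase U -> U !=set0 -> prescribable (act := act) U.
  move=> [l [g [k ->]]] [x0 /= wx0].
  apply: (@prescribableS _ _ _ [set x | zariski_word l g k x <> 1%g]).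
    by move=> x /= + /esym.
  apply: (prescribable_moving act_action _ x0).
    exact: finitely_tracked_zariski_word.
  apply: open_infinite => //.
    by apply: open_moved_points => //; exact: (act_homeo _).1.
  apply: contrapT => unmoved; apply/wx0/esym/act_faithful => p.
  by apply: contrapT => moved; apply: unmoved; exists p.
have open_prescribable (U : set (group_zariski G)) :
    open U -> U !=set0 -> prescribable (act := act) U.
  move=> oU [x Ux]; have [E [finE EU VU]] := group_zariski_open_base _ _ _ oU Ux.
  apply: prescribableS VU _; apply: prescribable_bigcap => // W /EU[sW Wx].
  by apply: subbase_prescribable => //; exists x.
move=> K1 K2 cK1 cK2 K1T K2T K12.
have [g []] : (~` K1 `&` ~` K2) !=set0.
  apply: (prescribable_nonempty _ act_highly_transitive).
  apply: prescribableI; apply: open_prescribable; rewrite ?openC//.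
    by rewrite -[X in X !=set0]setTI; exact: nonsubset K1T.2.
  by rewrite -[X in X !=set0]setTI; exact: nonsubset K2T.2.
by have [] : (K1 `|` K2) g by rewrite K12.
Qed.
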